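(* Let $G$ be a group with identity $e$, equipped with a binary relation $\rho$ compatible with the group operation, and let $x\in G$, $x\ne e$. Then $S_\rho(e,x)$ is a subgroup of $G$. If $\rho$ is a partial order, this subgroup is convex.
   Context: A binary relation $\rho$ on a group $G$ is compatible with the group operation if for all $a,b,x,y\in G$: $x\,\rho\,y\iff axb\,\rho\,ayb$. Let $\rho$ be a binary relation on a set $X$. A subset $M\subseteq X$ is a module of $(X,\rho)$ if for every $x\in X\setminus M$ and all $m,m'\in M$: $x\,\rho\,m\iff x\,\rho\,m'$ and $m\,\rho\,x\iff m'\,\rho\,x$. A nonempty module $M$ is strong if every module is disjoint from $M$, contained in $M$, or contains $M$. $S_\rho(x,y)$ is the intersection of all strong modules containing $x$ and $y$; it is the least strong module containing both. For a partial order, a subset $C$ is convex if $a\le z\le b$ with $a,b\in C$ implies $z\in C$. *)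

(* Defs.v *)
From Stdlib Require Relation_Definitions.
From mathcomp Require Import all_boot.
From mathcomp Require Import boolp classical_sets.

Set Implicit Arguments.
Unset Strict Implicit.
Unset Printing Implicit Defensive.

Local Open Scope classical_set_scope.

Definition compatible (G : groupType) (rho : G -> G -> Prop) : Prop :=
  forall a b x y : G, rho x y <-> rho (a * x * b)%g (a * y * b)%g.

Definition is_module (X : Type) (rho : X -> X -> Prop) (M : set X) : Prop :=
  forall x : X, ~ M x -> forall m m' : X, M m -> M m' ->
    (rho x m <-> rho x m') /\ (rho m x <-> rho m' x).

Definition strong_module (X : Type) (rho : X -> X -> Prop) (M : set X) : Prop :=
  [/\ M !=set0, is_module rho M &
      forall N : set X, is_module rho N ->
        [\/ N `&` M = set0, N `<=` M | M `<=` N]].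

Definition least_strong_module (X : Type) (rho : X -> X -> Prop) (x y : X) : set X :=
  smallest (strong_module rho) [set x; y].

Definition convex (X : Type) (le : X -> X -> Prop) (C : set X) : Prop :=
  forall a z b : X, C a -> C b -> le a z -> le z b -> C z.

(* Main.v *)
(** Because [rho] is invariant on both sides, left and right translations are
    automorphisms of [rho] and inversion is an anti-automorphism (multiply
    [a rho b] by [b^-1] on the left and [a^-1] on the right); all of them
    preserve strong modules.  A strong module [M] containing [1] overlaps
    [M^-1], so the two are comparable, hence equal.  Applying this inverse
    closure to the translate [g^-1 M], for [g] in [M], gives [g^2] in [M].
    Therefore, whenever [M] contains [1] and [x], so does [M x^-1]; minimality
    of [S = S_rho(1, x)] gives [S x] included in [S].  For [g] in [S], the
    elements [g] and [g x] thus lie in [S], so [g^-1 M] contains [1] and [x]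
    for every such [M], and minimality again gives [g S] included in [S]. *)

Require Import Defs.
From Stdlib Require Relation_Definitions.
From mathcomp Require Import all_boot.
From mathcomp Require Import boolp classical_sets.

Local Open Scope classical_set_scope.
Local Open Scope group_scope.

Lemma is_module_preimage (X Y : Type) (rho : X -> X -> Prop)
    (sigma : Y -> Y -> Prop) (f : X -> Y) (M : set Y) :
  (forall x y, rho x y <-> sigma (f x) (f y)) ->
  is_module sigma M -> is_module rho (f @^-1` M).
Proof.
move=> f_rho Mmod x nMx m m' Mm Mm'.
by have [? ?] := Mmod _ nMx _ _ Mm Mm'; rewrite !f_rho.
Qed.

(** As [f] is bijective, each module of [rho] is carried along [g] to a module of [sigma], where it
    can be compared with [M]. *)
Lemma strong_module_preimage (X Y : Type) (rho : X -> X -> Prop)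
    (sigma : Y -> Y -> Prop) (f : X -> Y) (g : Y -> X) (M : set Y) :
  cancel f g -> cancel g f ->
  (forall x y, rho x y <-> sigma (f x) (f y)) ->
  strong_module sigma M -> strong_module rho (f @^-1` M).
Proof.
move=> fK gK f_rho [[m Mm] Mmod Mstrong]; split.
- by exists (g m); rewrite /= gK.
- exact: is_module_preimage Mmod.
move=> N Nmod.
have gNmod : is_module sigma (g @^-1` N).
  by apply: is_module_preimage Nmod => x y; rewrite f_rho !gK.
have [NM0|NM|MN] := Mstrong _ gNmod.
- apply: Or31; rewrite -subset0 => y [Ny My].
  suff : set0 (f y) by [].
  by rewrite -NM0; split; rewrite /= ?fK.
- by apply: Or32 => y Ny; apply: NM; rewrite /= fK.
- by apply: Or33 => y /MN; rewrite /= fK.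
Qed.

Lemma is_module_flip (X : Type) (rho : X -> X -> Prop) (M : set X) :
  is_module rho M -> is_module (fun x y => rho y x) M.
Proof. by move=> Mmod x nMx m m' Mm Mm'; have [] := Mmod _ nMx _ _ Mm Mm'. Qed.

Lemma strong_module_flip (X : Type) (rho : X -> X -> Prop) (M : set X) :
  strong_module rho M -> strong_module (fun x y => rho y x) M.
Proof.
move=> [M0 Mmod Mstrong]; split => //; first exact: is_module_flip.
by move=> N /is_module_flip/Mstrong.
Qed.

(** A [z] outside [M] and below [b] would also be below [a]; antisymmetry then gives [z = a], a
    contradiction. *)
Lemma is_module_convex (X : Type) (rho : X -> X -> Prop) (M : set X) :
  Relation_Definitions.order X rho -> is_module rho M -> convex rho M.
Proof.
move=> [_ _ anti] Mmod a z b Ma Mb az zb; apply: contrapT => nMz.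
have [zaE _] := Mmod _ nMz _ _ Ma Mb.
by apply: (nMz); rewrite -(anti _ _ az (zaE.2 zb)).
Qed.

Section CompatibleRelation.
Context {G : groupType} {rho : G -> G -> Prop} (rho_compat : compatible rho).
Implicit Types (M : set G) (g x u v : G).

Lemma strong_module_lmul M g :
  strong_module rho M -> strong_module rho (mul g @^-1` M).
Proof.
apply: (strong_module_preimage _ _ _ _ _ (mul g^-1)) => [||x y].
- exact: mulKg.
- exact: mulVKg.
- by have := rho_compat g 1 x y; rewrite !mulg1.
Qed.

Lemma strong_module_rmul M g :
  strong_module rho M -> strong_module rho (mul^~ g @^-1` M).
Proof.
apply: (strong_module_preimage _ _ _ _ _ (mul^~ g^-1)) => [||x y].
- exact: mulgK.
- exact: mulgVK.
- by have := rho_compat 1 g x y; rewrite !mul1g.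
Qed.

Lemma strong_module_inv M :
  strong_module rho M -> strong_module rho (inv @^-1` M).
Proof.
(* Inversion reverses [rho], hence the flip. *)
move=> /strong_module_flip; apply: (strong_module_preimage _ _ _ _ _ inv).
- exact: invgK.
- exact: invgK.
- by move=> x y; have := rho_compat y^-1 x^-1 x y; rewrite mulgK mulVg mul1g.
Qed.

Lemma strong_module1_invg M u :
  strong_module rho M -> M 1 -> M u -> M u^-1.
Proof.
move=> Mst M1 Mu; have [_ Vmod _] := strong_module_inv M Mst.
(* The common element [1] excludes disjointness; either inclusion alone suffices. *)
have [_ _ /(_ _ Vmod)[VM0|VM|MV]] := Mst.
- suff : set0 (1 : G) by [].
  by rewrite -VM0; split; rewrite /= ?invg1.
- by apply: VM; rewrite /= invgK.
- exact: MV.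
Qed.

Lemma strong_module1_sqr M u :
  strong_module rho M -> M 1 -> M u -> M (u * u).
Proof.
(* The translate contains [1] and [u^-1], hence also [(u^-1)^-1]. *)
move=> Mst M1 Mu; rewrite -{2}(invgK u).
apply: (strong_module1_invg (mul u @^-1` M)); first exact: strong_module_lmul.
  by rewrite /= mulg1.
by rewrite /= mulgV.
Qed.

Lemma least_strong_module_mulr x u :
  least_strong_module rho 1 x u -> least_strong_module rho 1 x (u * x).
Proof.
move=> Su M [Mst Msub]; have M1 : M 1 by apply: Msub; left.
have Mx : M x by apply: Msub; right.
apply: (Su (mul^~ x @^-1` M)); split; first exact: strong_module_rmul.
move=> _ [->|->] /=; first by rewrite mul1g.
exact: strong_module1_sqr.
Qed.

Lemma least_strong_module_mul x u v :
  least_strong_module rho 1 x u -> least_strong_module rho 1 x v ->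
  least_strong_module rho 1 x (u * v).
Proof.
move=> Su Sv M [Mst Msub].
apply: (Sv (mul u @^-1` M)); split; first exact: strong_module_lmul.
move=> _ [->|->] /=; first by rewrite mulg1; apply: Su.
exact: least_strong_module_mulr Su M (conj Mst Msub).
Qed.

Lemma least_strong_module_inv x u :
  least_strong_module rho 1 x u -> least_strong_module rho 1 x u^-1.
Proof.
move=> Su M [Mst Msub]; apply: strong_module1_invg => //; last exact: Su.
by apply: Msub; left.
Qed.

End CompatibleRelation.

Theorem theorem3p1 (G : groupType) (rho : G -> G -> Prop)
    (rho_compat : compatible rho) (x : G) (x_neq1 : x <> 1%g) :
  group_closed (mem (least_strong_module rho 1%g x))
  /\ (Relation_Definitions.order G rho ->
      convex rho (least_strong_module rho 1%g x)).
Proof.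
split.
  split=> [|u v]; rewrite !inE; first by move=> M [_]; apply; left.
  move=> Su Sv; apply: least_strong_module_mul => //.
  exact: least_strong_module_inv.
(* Convexity passes to intersections, so it is checked in each strong module [M] containing [1] and
   [x]. *)
move=> rho_order a z b Sa Sb az zb M /[dup] Mst [[_ Mmod _] _].
exact: (is_module_convex _ _ _ rho_order Mmod a z b (Sa M Mst) (Sb M Mst)).
Qed.
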